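(* Let $G=(V,E)$ be a finite connected simple graph with $n$ vertices. (1) For positive integers $c$ and $k$: $\gamma_{ck}(G)\leq c\gamma_k(G)$ and $\gamma_{ck}^s(G)\leq c\gamma_k^s(G)$. (2) For positive integers $c,k$ and every $\gamma_k(G)$-function $f=(V_0,\dots,V_k)$, with $A_k=\lfloor k/2\rfloor$, $$\gamma_{ck+1}(G)\leq c\gamma_k(G)+\sum_{0\leq i\leq A_k}|V_i|\leq c\gamma_k(G)+|V|.$$ (3) For positive integers $c,k$ and every $\gamma_k^s(G)$-function $f=(V_0,\dots,V_k)$, $$\gamma_{ck+1}^s(G)\leq c\gamma_k^s(G)+|V|-|V_0|\leq (c+1)\gamma_k^s(G).$$ (4) Suppose $n\geq 3$ and $k\geq 2$. If $k$ is even, then $\gamma_k(G)\leq 3kn/8$ and $\gamma_k^s(G)\leq 2kn/5$; if $k$ is odd, then $\gamma_k(G)\leq (3k+5)n/8$ and $\gamma_k^s(G)\leq 2(k+1)n/5$.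
   Context: For a positive integer $k$ and $f:V\to\{0,1,\dots,k\}$, write $V_i=\{v\in V: f(v)=i\}$, $f=(V_0,\dots,V_k)$, and $w(f)=\sum_{v\in V}f(v)$. $f$ is a Roman $k$-dominating function ($k$-RDF) if every $u$ with $f(u)<k/2$ satisfies $\sum_{v\in N_G[u]}f(v)\geq k$ (closed neighbourhood); it is a strong Roman $k$-dominating function ($k$-SRDF) if every $u$ with $f(u)<k/2$ satisfies $f(u)+\sum_{v\in N_G(u),\, f(v)>k/2}f(v)\geq k$ (open neighbourhood). $\gamma_k(G)$ (resp. $\gamma_k^s(G)$) is the minimum weight of a $k$-RDF (resp. $k$-SRDF); a $\gamma_k(G)$-function (resp. $\gamma_k^s(G)$-function) is a $k$-RDF (resp. $k$-SRDF) attaining this minimum. *)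

(* Defs.v *)
From mathcomp Require Import all_boot all_order all_algebra.

Set Implicit Arguments.
Unset Strict Implicit.
Unset Printing Implicit Defensive.

(* A finite simple graph is an edge relation [e] on a finite type [V], assumed
   symmetric and irreflexive where it is used. *)

Definition connected_graph (V : finType) (e : rel V) : Prop :=
  0 < #|V| /\ forall x y : V, connect e x y.

Section Roman.

Variables (V : finType) (e : rel V) (k : nat).

Implicit Types (f : {ffun V -> 'I_k.+1}) (u v : V).

Definition open_nbh u : {set V} := [set v | e u v].

Definition closed_nbh u : {set V} := u |: open_nbh u.

Definition level f (i : nat) : {set V} := [set v | f v == i :> nat].

Definition weight f : nat := \sum_v f v.

(* The rational comparisons f(u) < k/2 and f(v) > k/2 are written
   2 f(u) < k and k < 2 f(v). *)

Definition is_RDF f : bool :=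
  [forall u, ((f u).*2 < k) ==> (k <= \sum_(v in closed_nbh u) f v)].

Definition is_SRDF f : bool :=
  [forall u, ((f u).*2 < k) ==>
     (k <= f u + \sum_(v in open_nbh u | k < (f v).*2) f v)].

Definition RDF_weight (m : nat) : bool :=
  [exists f, is_RDF f && (weight f == m)].

Definition SRDF_weight (m : nat) : bool :=
  [exists f, is_SRDF f && (weight f == m)].

(* The constant function k is always a (strong) k-RDF. *)

Lemma RDF_weight_ex : exists m, RDF_weight m.
Proof.
exists (weight [ffun => ord_max]); apply/existsP; exists [ffun => ord_max].
rewrite eqxx andbT; apply/forallP=> u; rewrite ffunE /=.
by rewrite ltnNge -addnn leq_addl.
Qed.

Lemma SRDF_weight_ex : exists m, SRDF_weight m.
Proof.
exists (weight [ffun => ord_max]); apply/existsP; exists [ffun => ord_max].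
rewrite eqxx andbT; apply/forallP=> u; rewrite ffunE /=.
by rewrite ltnNge -addnn leq_addl.
Qed.

Definition gamma : nat := ex_minn RDF_weight_ex.

Definition gamma_s : nat := ex_minn SRDF_weight_ex.

Definition is_gamma_function f : Prop := is_RDF f /\ weight f = gamma.

Definition is_gamma_s_function f : Prop := is_SRDF f /\ weight f = gamma_s.

End Roman.

(* Main.v *)
Require Import Defs.
From mathcomp Require Import all_boot all_order all_algebra.
From mathcomp Require Import zify.

(* The scaling bounds come from the functions c f and c f + 1, the unit being
   added only on {f <= k/2} in the ordinary case and on {f > 0} in the strong
   one.  By scaling, the last part reduces to k = 2, i.e. to the inequalities
   5 gamma_2^s <= 4 n and 4 gamma_2 <= 3 n.

   For these, the vertices of G are partitioned into spiders: a body c, a set L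
   of at least two neighbours of c, and at most |L| further vertices T.  The
   weights 2 on c, 1 on T and 0 on L dominate a spider and satisfy both
   inequalities, except that the five-vertex path needs the weights 1,0,1,0,1 for
   the second.  The partition is obtained by repeatedly cutting from a rooted
   spanning tree a vertex with at least two children, all of them leaves, or
   else the whole subtree of a deepest vertex having grandchildren. *)

Set Implicit Arguments.
Unset Strict Implicit.
Unset Printing Implicit Defensive.

Import GRing.Theory Num.Theory.

(** * Scaling from [k] to [c * k] and to [c * k + 1] *)

Section Scaling.

Variables (V : finType) (e : rel V).

Lemma gamma_le k (f : {ffun V -> 'I_k.+1}) :
  is_RDF e f -> gamma e k <= weight f.
Proof.
move=> fP; rewrite /gamma; case: ex_minnP => m _; apply.
by apply/existsP; exists f; rewrite fP eqxx.
Qed.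

Lemma gamma_s_le k (f : {ffun V -> 'I_k.+1}) :
  is_SRDF e f -> gamma_s e k <= weight f.
Proof.
move=> fP; rewrite /gamma_s; case: ex_minnP => m _; apply.
by apply/existsP; exists f; rewrite fP eqxx.
Qed.

Lemma gamma_function_ex k :
  exists f : {ffun V -> 'I_k.+1}, is_gamma_function e f.
Proof.
rewrite /is_gamma_function /gamma.
case: ex_minnP => m /existsP[f /andP[fP /eqP fm]] _.
by exists f.
Qed.

Lemma gamma_s_function_ex k :
  exists f : {ffun V -> 'I_k.+1}, is_gamma_s_function e f.
Proof.
rewrite /is_gamma_s_function /gamma_s.
case: ex_minnP => m /existsP[f /andP[fP /eqP fm]] _.
by exists f.
Qed.

(** [inord] is faithful only for values at most [m], which [bounded] below guarantees. *)
Definition affine_ffun m c k (f : {ffun V -> 'I_k.+1}) (B : {set V}) :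
    {ffun V -> 'I_m.+1} :=
  [ffun v => inord (c * f v + (v \in B))].

Section Affine.

Variables (m c k : nat) (f : {ffun V -> 'I_k.+1}) (B : {set V}).
Hypothesis bounded : forall v, c * f v + (v \in B) <= m.

Lemma affine_ffunE v : affine_ffun m c f B v = c * f v + (v \in B) :> nat.
Proof. by rewrite ffunE inordK ?ltnS. Qed.

Lemma weight_affine : weight (affine_ffun m c f B) = c * weight f + #|B|.
Proof.
rewrite /weight (eq_bigr _ (fun v _ => affine_ffunE v)) big_split /= -big_distrr.
by congr (_ + _); rewrite -sum1_card [RHS]big_mkcond.
Qed.

End Affine.

Lemma gamma_mul_le c k : 0 < c -> gamma e (c * k) <= c * gamma e k.
Proof.
move=> c0; have [f [/forallP fP <-]] := gamma_function_ex k.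
have bnd v : c * f v + (v \in set0) <= c * k.
  by rewrite inE addn0 leq_mul2l -ltnS ltn_ord orbT.
have := weight_affine bnd; rewrite cards0 addn0 => <-.
apply/gamma_le/forallP => u; apply/implyP; rewrite affine_ffunE // inE addn0.
rewrite doubleMr ltn_pmul2l // => /(implyP (fP u)) fu.
rewrite (eq_bigr _ (fun v _ => affine_ffunE bnd v)) big_split /= -big_distrr.
by rewrite (leq_trans _ (leq_addr _ _)) // leq_mul2l fu orbT.
Qed.

Lemma gamma_s_mul_le c k : 0 < c -> gamma_s e (c * k) <= c * gamma_s e k.
Proof.
move=> c0; have [f [/forallP fP <-]] := gamma_s_function_ex k.
have bnd v : c * f v + (v \in set0) <= c * k.
  by rewrite inE addn0 leq_mul2l -ltnS ltn_ord orbT.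
have := weight_affine bnd; rewrite cards0 addn0 => <-.
apply/gamma_s_le/forallP => u; apply/implyP; rewrite affine_ffunE // inE addn0.
rewrite doubleMr ltn_pmul2l // => /(implyP (fP u)) fu.
have fE v : affine_ffun (c * k) c f set0 v = c * f v :> nat.
  by rewrite affine_ffunE // inE addn0.
rewrite (eq_bigr _ (fun v _ => fE v)).
under eq_bigl => v do rewrite fE doubleMr ltn_pmul2l //.
by rewrite -big_distrr -mulnDr leq_mul2l fu orbT.
Qed.

(** A vertex that is small for [c * k + 1] is already small for [k], hence receives the extra unit.
    Lying in its own closed neighbourhood, it provides the missing unit itself. *)
Lemma gamma_mulS_le c k (f : {ffun V -> 'I_k.+1}) :
    0 < c -> 0 < k -> is_RDF e f ->
  gamma e (c * k + 1) <= c * weight f + #|[set v | (f v).*2 <= k]|.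
Proof.
move=> c0 k0 /forallP fP; set B := [set v | _].
have bnd v : c * f v + (v \in B) <= c * k + 1.
  by rewrite leq_add ?leq_b1 // leq_mul2l -ltnS ltn_ord orbT.
rewrite -(weight_affine bnd).
apply/gamma_le/forallP => u; apply/implyP; rewrite affine_ffunE // => small.
have fuk : (f u).*2 < k.
  by move: small; rewrite inE; case: leqP => /= ?; nia.
rewrite (eq_bigr _ (fun v _ => affine_ffunE bnd v)) big_split /= -big_distrr.
rewrite leq_add //; first by rewrite leq_mul2l (implyP (fP u)) ?orbT.
by rewrite (bigD1 u) ?setU11 //= inE (ltnW fuk).
Qed.

(** Here the missing unit comes from a large neighbour: a small vertex cannot reach [k] alone, so it
    has a large neighbour of positive value, and large vertices stay large after scaling. *)
Lemma gamma_s_mulS_le c k (f : {ffun V -> 'I_k.+1}) :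
    0 < c -> 0 < k -> is_SRDF e f ->
  gamma_s e (c * k + 1) <= c * weight f + #|[set v | 0 < f v]|.
Proof.
move=> c0 k0 /forallP fP; set B := [set v | _].
have bnd v : c * f v + (v \in B) <= c * k + 1.
  by rewrite leq_add ?leq_b1 // leq_mul2l -ltnS ltn_ord orbT.
rewrite -(weight_affine bnd).
apply/gamma_s_le/forallP => u; apply/implyP; rewrite affine_ffunE // => small.
have fuk : (f u).*2 < k.
  by move: small; rewrite inE; case: (posnP (f u)) => /= ?; nia.
have big v : k < (f v).*2 -> c * k + 1 < (affine_ffun (c * k + 1) c f B v).*2.
  by rewrite affine_ffunE // inE; case: (posnP (f v)) => /= ?; nia.
have {fP} := implyP (fP u) fuk.
set s := \sum_(v in _ | _) _ => ks.
have sle : c * s + (0 < s) <=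
    \sum_(v in open_nbh e u | c * k + 1 < (affine_ffun (c * k + 1) c f B v).*2)
      affine_ffun (c * k + 1) c f B v.
  apply: (@leq_trans (\sum_(v in open_nbh e u | k < (f v).*2)
      affine_ffun (c * k + 1) c f B v)); last first.
    rewrite big_mkcond [leqRHS]big_mkcond leq_sum //= => v _.
    by case: (v \in _) => //=; case: ifP => // /big ->.
  rewrite (eq_bigr _ (fun v _ => affine_ffunE bnd v)) big_split /= -big_distrr.
  rewrite leq_add2l; case: posnP => //= s0.
  have /existsP[v /andP[/andP[v1 v2] v3]] :
      [exists v, (v \in open_nbh e u) && (k < (f v).*2) && (0 < f v)].
    apply: contraTT s0; rewrite negb_exists => /forallP h.
    rewrite -leqNgt leqn0 /s big1 // => v vP.
    by apply/eqP; move: (h v); rewrite vP /= lt0n negbK.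
  by rewrite (bigD1 v) ?v1 //= inE v3.
apply: leq_trans (leq_add (leqnn _) sle).
by rewrite inE; case: (posnP (f u)) => /= ?; case: (posnP s) => /= ?; nia.
Qed.

Lemma card_pos_support k (f : {ffun V -> 'I_k.+1}) :
  #|[set v | 0 < f v]| = #|V| - #|level f 0|.
Proof.
rewrite -(cardsC (level f 0)) addKn; congr #|pred_of_set _|.
by apply/setP => v; rewrite !inE lt0n.
Qed.

Lemma card_pos_le_weight k (f : {ffun V -> 'I_k.+1}) :
  #|[set v | 0 < f v]| <= weight f.
Proof.
rewrite -sum1_card big_mkcond leq_sum //= => v _.
by rewrite inE; case: posnP.
Qed.

Lemma card_small_levels k (f : {ffun V -> 'I_k.+1}) :
  \sum_(0 <= i < (k %/ 2).+1) #|level f i| = #|[set v | (f v).*2 <= k]|.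
Proof.
rewrite -sum1_card.
rewrite (partition_big (fun v => inord (f v) : 'I_(k %/ 2).+1) predT) //=.
rewrite big_mkord; apply: eq_bigr => i _.
rewrite -sum1_card; apply: eq_bigl => v; rewrite !inE.
have i_le := ltn_ord i.
have -> : ((f v).*2 <= k) = (f v < (k %/ 2).+1) by lia.
(* When [f v] exceeds [k %/ 2], [inord] falls back on 0, but the condition on [f v] is then already
   false. *)
case: ltnP => [lt | ge]; last by rewrite gtn_eqF // (leq_trans i_le).
by rewrite -val_eqE /= inordK.
Qed.

End Scaling.

(** * Spiders, their tilings, and the bounds these give at [k = 2] *)

Section SpiderTilings.

Variables (V : finType) (e : rel V).

(* The body is [c], the feet are the elements of [L], and [T] stands for the
   far ends of the legs of length two; which foot carries which far end is
   irrelevant, except in the five-vertex path. *)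
Definition spider (c : V) (L T : {set V}) : Prop :=
  [/\ 2 <= #|L|, #|T| <= #|L|, L \subset open_nbh e c,
      (c \notin T) && [disjoint L & T]
    & #|L| = 2 -> #|T| = 2 -> {in L, forall l, exists2 t, t \in T & e l t}].

Definition spider_set (B : {set V}) : Prop :=
  exists c L T, spider c L T /\ B = c |: (L :|: T).

Inductive spider_tiled : {set V} -> Prop :=
| SpiderTiled0 : spider_tiled set0
| SpiderTiledU (B S : {set V}) :
    spider_set B -> [disjoint B & S] -> spider_tiled S -> spider_tiled (B :|: S).

Lemma spider_tiled1 B : spider_set B -> spider_tiled B.
Proof.
move=> BP; rewrite -[B]setU0; apply: SpiderTiledU => //.
  by rewrite disjoints_subset setC0 subsetT.
exact: SpiderTiled0.
Qed.

Section TiledBound.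

Variables (dominated : {set V} -> (V -> nat) -> V -> Prop) (a b : nat).

Hypothesis dominated_mono : forall (S S' : {set V}) (f g : V -> nat) u,
  S \subset S' -> {in S, f =1 g} -> dominated S f u -> dominated S' g u.

(** [dominated S f] is meant to rely on values inside [S] only, as [dominated_mono] expresses. Since
    the last bound is additive, such functions on disjoint sets can be glued. *)
Definition dominating_bounded (S : {set V}) (f : V -> nat) : Prop :=
  [/\ forall v, f v <= 2, {in S, forall u, f u = 0 -> dominated S f u}
    & a * \sum_(v in S) f v <= b * #|S|].

Lemma spider_tiled_bound S :
    (forall B, spider_set B -> exists f, dominating_bounded B f) ->
  spider_tiled S -> exists f, dominating_bounded S f.
Proof.
move=> spiderP; elim=> {S} [|B S /spiderP[f [f2 fB fle]] dBS _ [g [g2 gS gle]]].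
  exists (fun=> 0); split=> // [u|]; first by rewrite inE.
  by rewrite big_set0 muln0.
pose h v := if v \in B then f v else g v.
have hB : {in B, f =1 h} by move=> v vB; rewrite /h vB.
have hS : {in S, g =1 h}.
  by move=> v vS; rewrite /h; have := disjointFl dBS vS => ->.
exists h; split=> [v|u|]; first by rewrite /h; case: ifP.
  rewrite inE => /orP[uB | uS].
    rewrite -hB // => /(fB u uB); apply: dominated_mono => //.
    exact: subsetUl.
  rewrite -hS // => /(gS u uS); apply: dominated_mono => //.
  exact: subsetUr.
have -> : \sum_(v in B :|: S) h v = \sum_(v in B) f v + \sum_(v in S) g v.
  rewrite (eq_bigr _ hB) (eq_bigr _ hS) -bigU //=.
  by apply: eq_bigl => v; rewrite !inE.
by rewrite cardsU (disjoint_setI0 dBS) cards0 subn0 !mulnDr leq_add.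
Qed.

End TiledBound.

Definition spider_fun (a : nat) (c : V) (T : {set V}) (v : V) : nat :=
  if v == c then a else v \in T.

Lemma sum_spider_fun a c T (S : {set V}) :
  \sum_(v in S) spider_fun a c T v <= a + #|T|.
Proof.
apply: (@leq_trans (\sum_v spider_fun a c T v)).
  by rewrite [leqLHS]big_mkcond leq_sum //= => v _; case: ifP.
rewrite (bigD1 c) //= {1}/spider_fun eqxx leq_add2l -sum1_card.
rewrite [leqLHS]big_mkcond [leqRHS]big_mkcond leq_sum //= => v _.
by rewrite /spider_fun; case: (v == c) => //=; case: (v \in T).
Qed.

Hypotheses (e_sym : symmetric e) (e_irr : irreflexive e).

Lemma card_spider c L T : spider c L T -> #|c |: (L :|: T)| = (#|L| + #|T|).+1.
Proof.
case=> _ _ /subsetP LN /andP[cT dLT] _.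
rewrite cardsU1 inE negb_or cT andbT cardsU (disjoint_setI0 dLT) cards0 subn0.
by case: (boolP (c \in L)) => // /LN; rewrite inE e_irr.
Qed.

(** Classical Roman domination: the strong condition with [k = 2] at a vertex of weight 0, the
    dominating neighbour being kept in [S]. *)
Definition roman_dominated (S : {set V}) (f : V -> nat) (u : V) : Prop :=
  exists v, [/\ v \in S, e u v & f v = 2].

Lemma spider_roman B :
  spider_set B -> exists f, dominating_bounded roman_dominated 5 4 B f.
Proof.
move=> [c [L [T [sp ->]]]]; exists (spider_fun 2 c T).
have [L2 TL /subsetP LN _ _] := sp.
split=> [v|u|].
- by rewrite /spider_fun; case: eqP => //; case: (v \in T).
- rewrite !inE /spider_fun; case: eqP => //= _ /orP[uL | ->] // _.
  by exists c; rewrite !inE eqxx e_sym; split=> //; have := LN _ uL; rewrite inE.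
(* With [l] feet and [t] far ends, [5 (2 + t) <= 4 (1 + l + t)] amounts to [6 + t <= 4 l], which
   follows from [t <= l] and [2 <= l]. *)
- have := sum_spider_fun 2 c T (c |: (L :|: T)).
  by rewrite card_spider //; lia.
Qed.

(** Italian domination: the ordinary condition with [k = 2] at a vertex of weight 0. *)
Definition italian_dominated (S : {set V}) (f : V -> nat) (u : V) : Prop :=
  2 <= \sum_(v in S | e u v) f v.

Lemma spider_italian B :
  spider_set B -> exists f, dominating_bounded italian_dominated 4 3 B f.
Proof.
move=> [c [L [T [sp ->]]]].
have [L2 TL /subsetP LN /andP[cT dLT] P5] := sp.
have eLc u : u \in L -> e u c by rewrite e_sym => /LN; rewrite inE.
(* With [l] feet and [t] far ends, [4 (2 + t) <= 3 (1 + l + t)] amounts to [5 + t <= 3 l], which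
   fails only for [l = t = 2]. There the body gets 1, and each foot collects 1 from the body and 1
   from a far end. *)
have [/andP[/eqP L2' /eqP T2] | notP5] := boolP ((#|L| == 2) && (#|T| == 2)).
  exists (spider_fun 1 c T); split=> [v|u|].
  - by rewrite /spider_fun; case: eqP => //; case: (v \in T).
  - rewrite !inE {1}/spider_fun; case: eqP => //= _ /orP[uL | ->] // _.
    have [t tT eut] := P5 L2' T2 u uL.
    rewrite /italian_dominated (bigD1 c) ?setU11 ?eLc //= (bigD1 t) /=.
      rewrite /spider_fun eqxx tT.
      by case: eqP tT cT => // -> ->.
    by rewrite !inE tT eut !orbT /=; apply: contraNneq cT => <-.
  - have := sum_spider_fun 1 c T (c |: (L :|: T)).
    by rewrite card_spider //; lia.
exists (spider_fun 2 c T); split=> [v|u|].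
- by rewrite /spider_fun; case: eqP => //; case: (v \in T).
- rewrite !inE {1}/spider_fun; case: eqP => //= _ /orP[uL | ->] // _.
  by rewrite /italian_dominated (bigD1 c) ?setU11 ?eLc //= /spider_fun eqxx.
- have := sum_spider_fun 2 c T (c |: (L :|: T)).
  by rewrite card_spider //; lia.
Qed.

Lemma gamma_s_tiled : spider_tiled setT -> 5 * gamma_s e 2 <= 4 * #|V|.
Proof.
have mono (S S' : {set V}) (f g : V -> nat) u : S \subset S' ->
    {in S, f =1 g} -> roman_dominated S f u -> roman_dominated S' g u.
  move=> /subsetP sSS' fg [v [vS euv fv]]; exists v.
  by rewrite -fg // sSS'.
move=> /(spider_tiled_bound mono spider_roman)[f [f2 fD]].
rewrite cardsT => f_le; pose F : {ffun V -> 'I_3} := [ffun v => inord (f v)].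
have FE v : F v = f v :> nat by rewrite ffunE inordK // ltnS.
have : weight F = \sum_(v in setT) f v.
  rewrite /weight (eq_bigr _ (fun v _ => FE v)).
  by apply: eq_bigl => v; rewrite inE.
have : gamma_s e 2 <= weight F.
  apply/gamma_s_le/forallP => u; apply/implyP; rewrite FE => fu.
  have [||v [_ euv fv]] := fD u; [by rewrite inE | by lia |].
  by rewrite (bigD1 v) /= ?inE ?euv FE fv //; lia.
by lia.
Qed.

Lemma gamma_tiled : spider_tiled setT -> 4 * gamma e 2 <= 3 * #|V|.
Proof.
have mono (S S' : {set V}) (f g : V -> nat) u : S \subset S' ->
    {in S, f =1 g} -> italian_dominated S f u -> italian_dominated S' g u.
  move=> /subsetP sSS' fg; move=> /leq_trans; apply.
  rewrite big_mkcond [leqRHS]big_mkcond leq_sum //= => v _.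
  by case: (boolP (v \in S)) => //= vS; rewrite sSS' //= fg.
move=> /(spider_tiled_bound mono spider_italian)[f [f2 fD]].
rewrite cardsT => f_le; pose F : {ffun V -> 'I_3} := [ffun v => inord (f v)].
have FE v : F v = f v :> nat by rewrite ffunE inordK // ltnS.
have : weight F = \sum_(v in setT) f v.
  rewrite /weight (eq_bigr _ (fun v _ => FE v)).
  by apply: eq_bigl => v; rewrite inE.
have : gamma e 2 <= weight F.
  apply/gamma_le/forallP => u; apply/implyP; rewrite FE => fu.
  have fu0 : f u = 0 by lia.
  apply: leq_trans (fD u (in_setT u) fu0) _.
  rewrite (eq_bigr _ (fun v _ => FE v)) big_mkcond [leqRHS]big_mkcond leq_sum //=.
  by move=> v _; rewrite !inE; case: (e u v); rewrite ?orbT.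
by lia.
Qed.

End SpiderTilings.

(** * Rooted spanning trees and their pruning into spiders *)

Section RootedTree.

Variables (V : finType) (e : rel V).
Hypothesis e_sym : symmetric e.

(** [d] is the distance from [r]. The last vertex but one on a shortest path to [v] is a neighbour
    of [v] nearer to [r], so a parent can be picked. *)
Lemma spanning_tree_ex r :
    (forall v, connect e r v) ->
  exists (par : V -> V) (d : V -> nat),
    forall v, v != r -> e v (par v) /\ d (par v) < d v.
Proof.
move=> conn; pose P v n := [exists p : n.-tuple V, path e r p && (last r p == v)].
have exP v : exists n, P v n.
  have /connectP[p ep ->] := conn v; exists (size p).
  by apply/existsP; exists (in_tuple p); rewrite ep eqxx.
pose d v := ex_minn (exP v).
have closer v : v != r -> exists2 u, e v u & d u < d v.
  rewrite /d => vr; case: ex_minnP => [[|n] /existsP[p /andP[ep /eqP lp]] _].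
    by move: lp vr; rewrite tuple0 => /= ->; rewrite eqxx.
  have := size_tuple p; case/lastP: (tval p) ep lp => // q x.
  rewrite rcons_path last_rcons size_rcons => /andP[eq elx] <- [sq].
  exists (last r q); first by rewrite e_sym.
  case: ex_minnP => m _; apply; apply/existsP.
  by exists (Tuple (introT eqP sq)); rewrite eq eqxx.
(* Away from [r], [closer] keeps [pick] from falling back on its default. *)
exists (fun v => odflt v [pick u | e v u && (d u < d v)]), d => v /closer[u evu du].
by case: pickP => [w /andP[]|/(_ u)] //; rewrite evu du.
Qed.

Variables (r : V) (par : V -> V) (d : V -> nat).
Hypothesis par_adj : forall v, v != r -> e v (par v).
Hypothesis par_lt : forall v, v != r -> d (par v) < d v.

(** The nonempty such sets are the subtrees containing the root, which is what each cut leaves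
    behind. *)
Definition par_closed (S : {set V}) : Prop :=
  {in S, forall v, v != r -> par v \in S}.

(** The root is excluded because nothing constrains [par r]. *)
Definition children (S : {set V}) (v : V) : {set V} :=
  [set u in S | (u != r) && (par u == v)].

Lemma childrenP (S : {set V}) v u :
  reflect [/\ u \in S, u != r & par u = v] (u \in children S v).
Proof. by rewrite inE; apply: (iffP and3P) => -[? ? /eqP]. Qed.

(** A vertex of [S] with least [d] has no parent in [S], hence is the root. *)
Lemma par_closed_root (S : {set V}) v : par_closed S -> v \in S -> r \in S.
Proof.
move=> SP vS; have [u uS umin] := arg_minnP d vS.
have [<- // | ur] := eqVneq u r.
by have := par_lt ur; rewrite ltnNge (umin _ (SP u uS ur)).
Qed.

Lemma par_closedD (S B : {set V}) :
  par_closed S -> {in B, forall v, children S v \subset B} -> par_closed (S :\: B).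
Proof.
move=> SP BP v /setDP[vS vB] vr; rewrite inE SP // andbT.
apply: contra vB => /BP/subsetP; apply.
exact/childrenP.
Qed.

(** Of two vertices forming a subtree, one is the parent of the other. So a remainder of this size
    is [p] alone or [p] with a neighbour, ready to serve as a leg. *)
Lemma par_closed_small (S : {set V}) p :
    par_closed S -> p \in S -> #|S| <= 2 ->
  #|S :\ p| <= 1 /\ {in S :\ p, forall w, e p w}.
Proof.
move=> SP pS; rewrite (cardsD1 p) pS ltnS => small; split=> // w wS.
have uniq x : x \in S -> x != p -> x = w.
  move=> xS xp; apply: (card_le1_eqP small) => //.
  by rewrite !inE xp xS.
move: wS; rewrite !inE => /andP[wp wS].
have [wr | wr] := eqVneq w r.
  have pr : p != r by rewrite -wr eq_sym.
  rewrite -(uniq (par p)) ?par_adj // ?SP //.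
  by apply: contraTneq (par_lt pr) => ->; rewrite ltnn.
rewrite e_sym; have [<- | pp] := eqVneq (par w) p; first exact: par_adj.
by have := par_lt wr; rewrite (uniq (par w)) ?ltnn ?SP.
Qed.

(* A remainder [S :\: B] too small to be tiled becomes an extra leg
   [par q |: W] of the spider. *)
Lemma prune_spider (S B : {set V}) q :
    (forall S' : {set V}, #|S'| < #|S| -> par_closed S' -> 3 <= #|S'| ->
       spider_tiled e S') ->
    par_closed S -> B \subset S -> q \in B ->
    {in B, forall v, children S v \subset B} ->
    (q != r -> par q \notin B) ->
    spider_set e B ->
    (forall W : {set V}, q != r -> #|W| <= 1 -> {in W, forall w, e (par q) w} ->
       par q \notin W -> [disjoint W & B] ->
       spider_set e (B :|: (par q |: W))) ->
  spider_tiled e S.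
Proof.
move=> IH SP BS qB BP pqB spB spBW.
have S'P := par_closedD SP BP; set S' := S :\: B in S'P.
have defS : S = B :|: S' by rewrite /S' setDE setUIr setUCr setIT (setUidPr BS).
have dBS' : [disjoint B & S'].
  by rewrite disjoint_sym disjoints_subset subDset setUCr subsetT.
have [S'0 | [v vS']] := set_0Vmem S'.
  by rewrite defS S'0 setU0; apply: spider_tiled1.
(* A nonempty remainder contains the root, so [q] is not the root and its parent is left over. *)
have := par_closed_root S'P vS'; rewrite inE => /andP[rB _].
have qr : q != r by apply: contraNneq rB => <-.
have pqS' : par q \in S' by rewrite inE pqB //= SP // (subsetP BS).
have [small | big] := leqP #|S'| 2.
  have [W1 eW] := par_closed_small S'P pqS' small.
  rewrite defS -(setD1K pqS'); apply: spider_tiled1; apply: spBW => //.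
    by rewrite !inE eqxx.
  rewrite disjoint_sym; apply: disjointWr dBS'; exact: subsetDl.
rewrite defS; apply: SpiderTiledU => //; apply: IH => //.
apply: proper_card; apply/properP; split; first exact: subsetDl.
by exists q; rewrite ?(subsetP BS) // inE qB.
Qed.

(** Strong induction on [#|S|]. If no vertex has two or more children, all of them leaves, let [z]
    have maximal [d] among the vertices with grandchildren. The children of [z] then have only leaf
    children, hence at most one each, and the subtree of [z] consists of legs of length one or
    two. *)
Lemma spider_tiled_par_closed (S : {set V}) :
  par_closed S -> 3 <= #|S| -> spider_tiled e S.
Proof.
have [n] := ubnP #|S|; elim: n S => // n IHn S Sn SP S3.
have IH (S' : {set V}) : #|S'| < #|S| -> par_closed S' -> 3 <= #|S'| -> spider_tiled e S'.
  by move=> lt; apply: IHn; apply: leq_trans lt _.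
have par2 v : v != r -> par v != r -> par (par v) != v.
  move=> vr pr; apply: contraTneq (ltn_trans (par_lt pr) (par_lt vr)) => ->.
  by rewrite ltnn.
have par1 v : v != r -> par v != v.
  by move=> vr; apply: contraTneq (par_lt vr) => ->; rewrite ltnn.
have chS v : children S v \subset S by apply/subsetP => u /childrenP[].
have chN v : children S v \subset open_nbh e v.
  by apply/subsetP => u /childrenP[_ ur <-]; rewrite inE e_sym par_adj.
have chv v : v \notin children S v.
  by apply/childrenP => -[_ vr /eqP]; rewrite (negPf (par1 v vr)).
have pchv v : v != r -> par v \notin children S v.
  by move=> vr; apply/childrenP => -[_ pr /eqP]; rewrite (negPf (par2 v vr pr)).
have [/existsP[y /and3P[yS ych2 /forallP leaf]] | noB1] := boolP
    [exists y, [&& y \in S, 2 <= #|children S y| &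
       [forall u, (u \in children S y) ==> (children S u == set0)]]].
  apply: (@prune_spider S (y |: children S y) y) => //.
  - by rewrite subUset sub1set yS chS.
  - exact: setU11.
  - move=> v /setU1P[-> | vy]; first exact: subsetUr.
    by have := leaf v; rewrite vy => /eqP ->; apply: sub0set.
  - by move=> yr; rewrite in_setU1 (negPf (par1 y yr)) pchv.
  - exists y, (children S y), set0; rewrite setU0; split=> //.
    by split; rewrite ?cards0 ?inE ?chN // disjoint_sym disjoints_subset sub0set.
  - move=> W yr W1 _ pW; rewrite disjoints_subset => /subsetP WB.
    (* The parent of [y] becomes an extra foot with far end [W]. There are now at least three feet,
       so the clause on the five-vertex path is vacuous. *)
    exists y, (par y |: children S y), W; split; last first.
      by rewrite -!setUA; congr (_ :|: _); rewrite setUCA.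
    split.
    + by rewrite cardsU1 pchv //; lia.
    + by rewrite cardsU1 pchv //; lia.
    + by rewrite subUset chN sub1set inE par_adj.
    + apply/andP; split.
        by apply/negP => /WB; rewrite !inE eqxx.
      rewrite disjoint_sym disjoints_subset; apply/subsetP => w wW.
      have := WB w wW; rewrite !in_setC !in_setU1 !negb_or => /andP[_ ->].
      by rewrite andbT; apply: contraNneq pW => <-.
    + by rewrite cardsU1 pchv //; lia.
have le1 y : y \in S -> {in children S y, forall u, children S u = set0} ->
    #|children S y| <= 1.
  move=> yS leaf; rewrite leqNgt; apply/negP => ych2; case/negP: noB1.
  apply/existsP; exists y; rewrite yS ych2; apply/forallP => u.
  by apply/implyP => /leaf ->.
pose gc z := (z \in S) && [exists l in children S z, children S l != set0].
(* Without grandchildren, [S] would be the root and its children, all leaves, and [le1] would leave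
   at most two vertices. *)
have [z0 gcz0] : exists z, gc z.
  apply/existsP; apply: contraTT S3; rewrite negb_exists => /forallP nogc.
  have leaf v : v \in S -> {in children S v, forall l, children S l = set0}.
    move=> vS l lv; apply/eqP; apply: contraNT (nogc v) => lch.
    by rewrite /gc vS; apply/existsP; exists l; rewrite lv.
  have [-> | [v vS]] := set_0Vmem S; first by rewrite cards0.
  have rS := par_closed_root SP vS.
  have : S \subset r |: children S r.
    apply/subsetP => u uS; rewrite in_setU1; have [//|ur] := eqVneq u r.
    apply/childrenP; split=> //; apply/eqP/negPn/negP => pr.
    have puS := SP u uS ur.
    have /setP/(_ u) : children S (par u) = set0.
      by apply: (leaf (par (par u))); [exact: SP | apply/childrenP].
    by rewrite !inE uS ur eqxx.
  move/subset_leq_card; rewrite cardsU1 chv => le; rewrite -leqNgt.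
  by apply: leq_trans le _; rewrite ltnS; apply: le1 (leaf r rS).
have [z /andP[zS /existsP[y0 /andP[y0z y0ch]]] zmax] := arg_maxnP d gcz0.
have leaf l : l \in children S z ->
    {in children S l, forall t, children S t = set0}.
  move=> /childrenP[lS lr lz] t tl; apply/eqP/negPn/negP => tch.
  have /zmax : gc l by rewrite /gc lS; apply/existsP; exists t; rewrite tl.
  by rewrite /= -lz leqNgt par_lt.
set L := children S z in y0z leaf.
pose T := [set u in S | (u != r) && (par u \in L)].
have TP t : t \in T -> [/\ t != r, par t \in L & t \in children S (par t)].
  by rewrite inE => /and3P[tS tr ptL]; split=> //; apply/childrenP.
have L_le1 l : l \in L -> #|children S l| <= 1.
  by move=> lL; apply: le1 (leaf l lL); apply: subsetP (chS z) l lL.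
(* Each foot carries at most one far end, so [par] embeds [T] in [L]. When the cardinals agree it is
   onto, which gives the last clause of [spider]. *)
have par_inj : {in T &, injective par}.
  move=> t t' /TP[_ pL tch] /TP[_ _ tch'] ptt'.
  by apply: (card_le1_eqP (L_le1 _ pL)) => //; rewrite ptt'.
have parTL : par @: T \subset L by apply/subsetP => _ /imsetP[t /TP[_ ? _] ->].
have cardT := card_in_imset par_inj.
have TL : #|T| <= #|L| by rewrite -cardT subset_leq_card.
have adj : #|T| = #|L| -> {in L, forall l, exists2 t, t \in T & e l t}.
  move=> eqTL l; have : L \subset par @: T.
    have [_] := subset_leqif_cards parTL.
    by rewrite cardT eqTL eqxx => /esym/eqP ->.
  move=> /subsetP LT /LT /imsetP[t tT ->]; exists t => //.
  by rewrite e_sym par_adj //; case/TP: tT.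
have T_gt0 : 0 < #|T|.
  have /set0Pn[t ty] := y0ch; apply/card_gt0P; exists t.
  by case/childrenP: ty => tS tr pt; rewrite inE tS tr pt.
have dLT : [disjoint L & T].
  apply/pred0P => t /=; apply/negP => /andP[/childrenP[_ _ pt] /TP[_]].
  by rewrite pt (negPf (chv z)).
have zT : z \notin T by apply/negP => /TP[zr]; rewrite (negPf (pchv z zr)).
(* Otherwise [z] would be its own third ancestor, against the decrease of [d]. *)
have pzT : z != r -> par z \notin T.
  move=> zr; apply/negP => /TP[pr /childrenP[_ ppr ppz] _].
  have := par_lt ppr; rewrite ppz => lt.
  by have := ltn_trans lt (ltn_trans (par_lt pr) (par_lt zr)); rewrite ltnn.
apply: (@prune_spider S (z |: (L :|: T)) z) => //.
- rewrite subUset sub1set zS subUset chS /=.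
  by apply/subsetP => t; rewrite inE => /andP[].
- exact: setU11.
- move=> v; rewrite !in_setU in_set1 => /or3P[/eqP -> | vL | /TP[_ pL vp]].
  + exact: subset_trans (subsetUl _ _) (subsetUr _ _).
  + apply/subsetP => u /childrenP[uS ur puv].
    by rewrite !in_setU [u \in T]inE uS ur puv vL !orbT.
  + by rewrite (leaf _ pL v vp) sub0set.
- by move=> zr; rewrite !in_setU in_set1 !negb_or par1 // pchv // pzT.
(* A single foot is too few for the body [z], but the subtree is then a path on three vertices, and
   its middle vertex [y] is taken as body. *)
- have [L1 | L2] := leqP #|L| 1; last first.
    exists z, L, T; split=> //; split=> //; first exact: chN.
      exact/andP.
    by move=> L_2 T_2; apply: adj; rewrite T_2.
  have L1' : #|L| = 1 by lia.
  have /cards1P[y Ly] : #|L| == 1 by rewrite L1'.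
  have yL : y \in L by rewrite Ly set11.
  exists y, (z |: T), set0; split; last by rewrite setU0 Ly setUCA.
  split; rewrite ?cards0 ?cardsU1 ?zT //.
  + rewrite subUset sub1set inE e_sym.
    have := subsetP (chN z) _ yL; rewrite inE => -> /=.
    apply/subsetP => t /TP[_]; rewrite Ly => /set1P -> tch.
    exact: subsetP (chN y) _ tch.
  + by rewrite inE disjoint_sym disjoints_subset sub0set.
- move=> W zr W1 eW pW; rewrite disjoints_subset => /subsetP WB.
  have cL : #|par z |: L| = #|L|.+1 by rewrite cardsU1 pchv.
  have cT : #|T :|: W| <= #|T| + #|W| by rewrite cardsU leq_subr.
  (* The new leg adds one foot and at most one far end. As [L] is nonempty, there are two feet even
     when [L] is a singleton. *)
  exists z, (par z |: L), (T :|: W); split; last first.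
    by rewrite -!setUA; congr (_ :|: _); rewrite [T :|: _]setUCA setUCA.
  split; rewrite ?cL.
  + by lia.
  + by lia.
  + by rewrite subUset chN sub1set inE par_adj.
  + apply/andP; split.
      rewrite in_setU (negPf zT) /=.
      by apply/negP => /WB; rewrite in_setC setU11.
    rewrite disjoint_sym disjoints_subset; apply/subsetP => w.
    rewrite in_setU !in_setC in_setU1 negb_or => /orP[wT | wW].
      have := disjointFl dLT wT => ->; rewrite andbT.
      by apply: contraTneq wT => ->; apply: pzT.
    have := WB w wW; rewrite in_setC !in_setU !negb_or => /and3P[_ -> _].
    by rewrite andbT; apply: contraNneq pW => <-.
  (* Two feet and two far ends force [L], [T] and [W] to be singletons: [par z] is joined to the
     vertex of [W], and the foot in [L] to that of [T]. *)
  + move=> L1 TW l; rewrite in_setU1 => /orP[/eqP -> | lL].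
      have /card_gt0P[w wW] : 0 < #|W| by lia.
      by exists w; [rewrite in_setU wW orbT | apply: eW].
    have [|t tT elt] := adj _ l lL; first by lia.
    by exists t; rewrite // in_setU tT.
Qed.

End RootedTree.

(** * Tiling a connected graph, and the final bounds *)

Lemma connected_spider_tiled (V : finType) (e : rel V) :
    symmetric e -> irreflexive e -> connected_graph e -> 3 <= #|V| ->
  spider_tiled e setT.
Proof.
move=> e_sym e_irr [/card_gt0P[r _] conn] V3.
have [par [d parP]] := spanning_tree_ex e_sym (conn r).
apply: (@spider_tiled_par_closed V e e_sym r par d) => [v /parP[]|v /parP[]||] //.
by rewrite cardsT.
Qed.

Theorem theorem2p3 (V : finType) (e : rel V)
    (e_sym : symmetric e) (e_irr : irreflexive e)
    (e_conn : connected_graph e) :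
  (forall c k : nat, 0 < c -> 0 < k ->
     gamma e (c * k) <= c * gamma e k /\
     gamma_s e (c * k) <= c * gamma_s e k) /\
  (forall (c k : nat) (f : {ffun V -> 'I_k.+1}), 0 < c -> 0 < k ->
     is_gamma_function e f ->
     gamma e (c * k + 1)
       <= c * gamma e k + \sum_(0 <= i < (k %/ 2).+1) #|level f i|
       <= c * gamma e k + #|V|) /\
  (forall (c k : nat) (f : {ffun V -> 'I_k.+1}), 0 < c -> 0 < k ->
     is_gamma_s_function e f ->
     gamma_s e (c * k + 1)
       <= c * gamma_s e k + (#|V| - #|level f 0|)
       <= (c + 1) * gamma_s e k) /\
  (forall k : nat, 3 <= #|V| -> 2 <= k ->
     (~~ odd k ->
        ((gamma e k)%:R <= 3 * k%:R * #|V|%:R / 8 :> rat)%R /\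
        ((gamma_s e k)%:R <= 2 * k%:R * #|V|%:R / 5 :> rat)%R) /\
     (odd k ->
        ((gamma e k)%:R <= (3 * k%:R + 5) * #|V|%:R / 8 :> rat)%R /\
        ((gamma_s e k)%:R <= 2 * (k%:R + 1) * #|V|%:R / 5 :> rat)%R)).
Proof.
split; first by move=> c k c0 _; rewrite gamma_mul_le ?gamma_s_mul_le.
have part2 c k (f : {ffun V -> 'I_k.+1}) : 0 < c -> 0 < k ->
    is_gamma_function e f ->
    gamma e (c * k + 1)
      <= c * gamma e k + \sum_(0 <= i < (k %/ 2).+1) #|level f i|
      <= c * gamma e k + #|V|.
  move=> c0 k0 [fP <-]; rewrite card_small_levels gamma_mulS_le //.
  by rewrite leq_add2l max_card.
have part3 c k (f : {ffun V -> 'I_k.+1}) : 0 < c -> 0 < k ->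
    is_gamma_s_function e f ->
    gamma_s e (c * k + 1)
      <= c * gamma_s e k + (#|V| - #|level f 0|) <= (c + 1) * gamma_s e k.
  move=> c0 k0 [fP <-]; rewrite -card_pos_support gamma_s_mulS_le //.
  by rewrite mulnDl mul1n leq_add2l card_pos_le_weight.
split=> //; split=> // k V3 k2.
have tiled := connected_spider_tiled e_sym e_irr e_conn V3.
have g2 := gamma_tiled e_sym e_irr tiled.
have gs2 := gamma_s_tiled e_sym e_irr tiled.
have half0 : 0 < k./2 by lia.
split=> parity.
  (* Scaling by [k./2] from level 2 turns [3 n / 4] and [4 n / 5] into [3 k n / 8] and
     [2 k n / 5]. *)
  have k_half : k = k./2 * 2 by lia.
  have := gamma_mul_le e 2 half0; have := gamma_s_mul_le e 2 half0.
  rewrite -k_half => les le.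
  by split; rewrite ler_pdivlMr ?ltr0n // -!natrM ler_nat; nia.
(* With [c = k./2 = (k - 1) / 2], the outer bounds of the second and third parts give
   [3 (k - 1) n / 8 + n = (3 k + 5) n / 8] and [(c + 1) 4 n / 5 = 2 (k + 1) n / 5]. *)
have k_half : k = k./2 * 2 + 1 by lia.
have [f fP] := gamma_function_ex e 2.
have [h hP] := gamma_s_function_ex e 2.
have /andP[lef lef'] := part2 k./2 2 f half0 isT fP.
have /andP[leh leh'] := part3 k./2 2 h half0 isT hP.
have {lef lef'} := leq_trans lef lef'; have {leh leh'} := leq_trans leh leh'.
rewrite -k_half => les le.
by split; rewrite ler_pdivlMr ?ltr0n // ?natr1 -!natrM -?natrD -?natrM ler_nat; nia.
Qed.
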